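(* Let $S = d_1 S_1 + d_2 S_2$ be a gluing of numerical semigroups $S_1$ and $S_2$. (a) If $S$ is an $\mathsf{M}_S$-harmonic gluing, then, with $A_2 = \operatorname{Ap}(S_2; d_1)$, $$\mathcal{H}_{\mathsf{M}_S}(S;t) = \mathcal{H}(S_1;t^{d_1}) \bigg( \sum_{n \in A_2} \mathsf{M}_{S_2}(n) (t^{d_2})^n \bigg) + \mathcal{H}_{\mathsf{M}_{S_1}}(S_1;t^{d_1}) \bigg( \sum_{n \in A_2} (t^{d_2})^n \bigg).$$ (b) If $S$ is an $\mathsf{m}_S$-harmonic gluing, then, with $A_1 = \operatorname{Ap}(S_1; d_2)$, $$\mathcal{H}_{\mathsf{m}_S}(S;t) = \bigg( \sum_{n \in A_1} \mathsf{m}_{S_1}(n) (t^{d_1})^n \bigg) \mathcal{H}(S_2;t^{d_2}) + \bigg( \sum_{n \in A_1} (t^{d_1})^n \bigg) \mathcal{H}_{\mathsf{m}_{S_2}}(S_2;t^{d_2}).$$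
   Context: A numerical semigroup is a subset $S \subseteq \mathbb{Z}_{\ge 0}$ containing $0$, closed under addition, with finite complement, taken with a fixed finite generating set $n_1 < \cdots < n_k$ of positive integers. A factorization of $n \in S$ is $a \in \mathbb{Z}_{\ge 0}^k$ with $n = a_1n_1 + \cdots + a_kn_k$; its length is $a_1 + \cdots + a_k$. $\mathsf{M}_S(n)$ and $\mathsf{m}_S(n)$ are the maximum and minimum factorization lengths of $n \in S$. For $n \in S$, the Apéry set is $\operatorname{Ap}(S;n) = \{m \in S : m - n \notin S\}$. The Hilbert series is $\mathcal{H}(S;t) = \sum_{n \in S} t^n$, and for a function $f$ on $S$ the augmented Hilbert series is $\mathcal{H}_f(S;t) = \sum_{n \in S} f(n) t^n$. Gluing: given numerical semigroups $S_1, S_2$ and elements $d_1 \in S_2$, $d_2 \in S_1$ that are not minimal generators of their respective semigroups, $S = d_1S_1 + d_2S_2 = \{d_1 n' + d_2 n'' : n' \in S_1, n'' \in S_2\}$ is a gluing of $S_1$ and $S_2$ if $\gcd(d_1,d_2) = 1$. The generators of $S$ are the products of $d_1$ with the generators of $S_1$ together with the products of $d_2$ with the generators of $S_2$. Harmonic gluings: $S = d_1S_1 + d_2S_2$ is an $\mathsf{M}_S$-harmonic gluing if every $n \in S$ satisfies $\mathsf{M}_S(n) = \mathsf{M}_{S_1}(n') + \mathsf{M}_{S_2}(n'')$, where $n = d_1n' + d_2n''$ with $n' \in S_1$, $n'' \in S_2$ and $n'$ maximal among all such expressions of $n$. It is an $\mathsf{m}_S$-harmonic gluing if every $n \in S$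 satisfies $\mathsf{m}_S(n) = \mathsf{m}_{S_1}(n') + \mathsf{m}_{S_2}(n'')$, where $n = d_1n' + d_2n''$ with $n' \in S_1$, $n'' \in S_2$ and $n''$ maximal among all such expressions of $n$. *)

(* Defs.v *)
From HB Require Import structures.
From mathcomp Require Import all_boot all_order all_algebra.
Set Implicit Arguments.
Unset Strict Implicit.
Unset Printing Implicit Defensive.
Import GRing.Theory.

Definition factors (g : seq nat) (n : nat) (a : 'I_(size g) -> nat) : bool :=
  n == \sum_(i < size g) a i * nth 0 g i.

Definition flength k (a : 'I_k -> nat) : nat := \sum_(i < k) a i.

(* The generating set need not be minimal.  A Boolean carrier loses no
   generality: membership in a finitely generated semigroup is decidable. *)
Record numsemigroup := NumSemigroup {
  ns_pred :> {pred nat};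
  ns_0 : 0 \in ns_pred;
  ns_add : {in ns_pred &, forall m n, m + n \in ns_pred};
  ns_cofinite : exists s : seq nat, forall n, n \notin ns_pred -> n \in s;
  ns_gens : seq nat;
  ns_gens_sorted : sorted ltn ns_gens;
  ns_gens_gt0 : all (ltn 0) ns_gens;
  ns_gens_span : forall n,
    n \in ns_pred <-> exists a : 'I_(size ns_gens) -> nat, factors n a
}.

(* Generators are positive, so the entries and the length of a factorization
   of n are at most n: ranging over 'I_n.+1 misses no factorization, and the
   starting value n of the minimum is harmless.  See maxlen_spec and minlen_spec.
   The values at n \notin S are junk. *)
Definition maxlen (S : numsemigroup) (n : nat) : nat :=
  \max_(a : {ffun 'I_(size (ns_gens S)) -> 'I_n.+1}
      | factors n (fun i => a i : nat))
    flength (fun i => a i : nat).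

Definition minlen (S : numsemigroup) (n : nat) : nat :=
  \big[minn/n]_(a : {ffun 'I_(size (ns_gens S)) -> 'I_n.+1}
      | factors n (fun i => a i : nat))
    flength (fun i => a i : nat).

Lemma factors_bound (S : numsemigroup) n (a : 'I_(size (ns_gens S)) -> nat) :
  factors n a -> flength a <= n.
Proof.
move=> /eqP ->; apply: leq_sum => i _; apply: leq_pmulr.
exact: (allP (ns_gens_gt0 S)) _ (mem_nth 0 (ltn_ord i)).
Qed.

Lemma factors_bounded (S : numsemigroup) n (a : 'I_(size (ns_gens S)) -> nat) :
  factors n a -> exists b : {ffun 'I_(size (ns_gens S)) -> 'I_n.+1},
    (fun i => b i : nat) =1 a.
Proof.
move=> Ha; exists [ffun i => inord (a i)] => i; rewrite ffunE inordK // ltnS.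
by apply: leq_trans (factors_bound Ha); rewrite /flength (bigD1 i) //= leq_addr.
Qed.

Lemma eq_factors g n (a b : 'I_(size g) -> nat) :
  a =1 b -> factors n a = factors n b.
Proof. by move=> ab; rewrite /factors; under eq_bigr do rewrite ab. Qed.

Lemma eq_flength k (a b : 'I_k -> nat) : a =1 b -> flength a = flength b.
Proof. by move=> ab; apply: eq_bigr. Qed.

Lemma maxlen_spec (S : numsemigroup) n : n \in S ->
  (exists2 a : 'I_(size (ns_gens S)) -> nat,
     factors n a & flength a = maxlen S n) /\
  (forall a : 'I_(size (ns_gens S)) -> nat,
     factors n a -> flength a <= maxlen S n).
Proof.
move=> /ns_gens_span[a0 Ha0]; split; last first.
  move=> a Ha; have [b ba] := factors_bounded Ha.
  rewrite -(eq_flength ba) /maxlen.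
  rewrite (bigD1 b) ?leq_maxl //.
  by rewrite (eq_factors n ba).
have [b0 b0a] := factors_bounded Ha0; rewrite -(eq_factors n b0a) in Ha0.
rewrite /maxlen (bigmax_eq_arg b0) //; case: arg_maxnP => // b Hb _.
by exists (fun i => b i : nat).
Qed.

Lemma minlen_spec (S : numsemigroup) n : n \in S ->
  (exists2 a : 'I_(size (ns_gens S)) -> nat,
     factors n a & flength a = minlen S n) /\
  (forall a : 'I_(size (ns_gens S)) -> nat,
     factors n a -> minlen S n <= flength a).
Proof.
move=> /ns_gens_span[a0 Ha0].
have lower (a : 'I_(size (ns_gens S)) -> nat) :
    factors n a -> minlen S n <= flength a.
  move=> Ha; have [b ba] := factors_bounded Ha.
  have Hb : factors n (fun i => b i : nat) by rewrite (eq_factors n ba).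
  rewrite -(eq_flength ba) /minlen.
  elim: (index_enum _) (mem_index_enum b) => // c s IHs.
  rewrite inE big_cons => /predU1P[<-|/IHs le_s]; first by rewrite Hb geq_minl.
  by case: ifP => // _; apply: leq_trans le_s; apply: geq_minr.
split=> //.
have : minlen S n = n \/ exists2 a : 'I_(size (ns_gens S)) -> nat,
    factors n a & flength a = minlen S n.
  rewrite /minlen; elim/big_ind: _ => [|x y|b Hb]; first by left.
  - by rewrite /minn; case: ifP.
  - by right; exists (fun i => b i : nat).
case=> // mn; exists a0 => //; apply/eqP.
by rewrite eqn_leq lower // andbT mn (factors_bound Ha0).
Qed.

Definition min_generator (S : numsemigroup) (n : nat) : Prop :=
  [/\ n \in S, 0 < n &
      ~ exists a b, [/\ a \in S, b \in S, 0 < a, 0 < b & n = a + b]].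

(* The guard n <= m undoes the truncation of subtraction: m - n is taken in
   the integers, and negative integers are not in S. *)
Definition Apery (S : numsemigroup) (n : nat) : {pred nat} :=
  [pred m | (m \in S) && ~~ ((n <= m) && (m - n \in S))].

Definition glue_expr (S1 S2 : numsemigroup) (d1 d2 n n1 n2 : nat) : Prop :=
  [/\ n1 \in S1, n2 \in S2 & n = d1 * n1 + d2 * n2].

Record gluing (S S1 S2 : numsemigroup) (d1 d2 : nat) : Prop := Gluing {
  gluing_d1 : d1 \in S2 /\ ~ min_generator S2 d1;
  gluing_d2 : d2 \in S1 /\ ~ min_generator S1 d2;
  gluing_coprime : gcdn d1 d2 = 1;
  gluing_mem : forall n, n \in S <->
    exists n1 n2, glue_expr S1 S2 d1 d2 n n1 n2;
  gluing_gens : ns_gens S =i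
    [seq d1 * g | g <- ns_gens S1] ++ [seq d2 * g | g <- ns_gens S2]
}.

Lemma gluing_gt0 (S S1 S2 : numsemigroup) d1 d2 :
  gluing S S1 S2 d1 d2 -> 0 < d1 /\ 0 < d2.
Proof.
have gen1 (T : numsemigroup) : 1 \in T -> min_generator T 1.
  by move=> T1; split=> // -[[|[|a]] [[|b] []]] //.
case=> [[d1S2 nd1] [d2S1 nd2] co _ _].
by split; rewrite lt0n; apply/eqP => d0; move: co; rewrite d0 ?gcd0n ?gcdn0 => d1';
  [apply: nd2; move: d2S1|apply: nd1; move: d1S2]; rewrite d1'; apply: gen1.
Qed.

Definition max_harmonic (S S1 S2 : numsemigroup) (d1 d2 : nat) : Prop :=
  forall n n1 n2, n \in S -> glue_expr S1 S2 d1 d2 n n1 n2 ->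
    (forall m1 m2, glue_expr S1 S2 d1 d2 n m1 m2 -> m1 <= n1) ->
    maxlen S n = maxlen S1 n1 + maxlen S2 n2.

Definition min_harmonic (S S1 S2 : numsemigroup) (d1 d2 : nat) : Prop :=
  forall n n1 n2, n \in S -> glue_expr S1 S2 d1 d2 n n1 n2 ->
    (forall m1 m2, glue_expr S1 S2 d1 d2 n m1 m2 -> m2 <= n2) ->
    minlen S n = minlen S1 n1 + minlen S2 n2.

(* Formal power series in t over the integers, as coefficient sequences. *)
Definition fps := nat -> int.

Declare Scope fps_scope.
Delimit Scope fps_scope with FPS.
Bind Scope fps_scope with fps.

Definition fps_add (f g : fps) : fps := fun n => (f n + g n)%R.

Definition fps_mul (f g : fps) : fps :=
  fun n => (\sum_(i < n.+1) f i * g (n - i)%N)%R.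

(* f(t^d), meaningful for d > 0 only; see gluing_gt0. *)
Definition fps_subst_Xn (f : fps) (d : nat) : fps :=
  fun n => if d %| n then f (n %/ d) else 0%R.

Notation "f + g" := (fps_add f g) : fps_scope.
Notation "f * g" := (fps_mul f g) : fps_scope.
Notation "f .[t^ d ]" := (fps_subst_Xn f d)
  (at level 2, d at level 200, left associativity, format "f .[t^ d ]")
  : fps_scope.

(* \sum_(n in A) f(n) t^n, for a finite or infinite set A. *)
Definition gseries (A : {pred nat}) (f : nat -> nat) : fps :=
  fun n => if n \in A then Posz (f n) else 0%R.

Definition augHilbert (f : nat -> nat) (S : numsemigroup) : fps := gseries S f.

Definition Hilbert (S : numsemigroup) : fps := gseries S (fun=> 1).

(* Main.v *)
(** By coprimality of [d1] and [d2], every [n] in the gluing [S] has exactly one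
    expression [d1 n1 + d2 n2] with [n1] in [S1] and [n2] in [Ap(S2; d1)], and it
    is the expression in which [n1] is maximal.  Harmonicity therefore makes the
    length of [n] additive along it, and each product of series on the right
    has a single nonzero term in degree [n].  Part (b) is part (a)'s argument with
    [S1] and [S2] exchanged. *)
Require Import Defs.
From mathcomp Require Import all_boot all_order all_algebra.
From mathcomp Require Import zify.

Import GRing.Theory.

Lemma fps_mulC (f g : fps) : (f * g)%FPS =1 (g * f)%FPS.
Proof.
move=> n; rewrite /fps_mul (reindex_inj rev_ord_inj) /=.
apply: eq_bigr => -[i /= le_in] _; rewrite subSS subKn; first exact: mulrC.
exact: le_in.
Qed.

Lemma gseries_subst_eq0 (A : {pred nat}) f d n :
  (forall a, a \in A -> n <> d * a) -> ((gseries A f).[t^ d])%FPS n = 0%R.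
Proof.
move=> noA; rewrite /fps_subst_Xn /gseries.
case: ifP => // dn; case: ifP => // /noA; case.
by rewrite mulnC divnK.
Qed.

Lemma gseries_subst_mul (A : {pred nat}) f d a : 0 < d -> a \in A ->
  ((gseries A f).[t^ d])%FPS (d * a) = Posz (f a).
Proof. by move=> d0 Aa; rewrite /fps_subst_Xn /gseries dvdn_mulr // mulKn ?Aa. Qed.

(** In the convolution, the term of index [i] has a zero first factor unless [i = d1 * a] with [a]
    in [A]; in that case [n - i] is no [d2 * b] with [b] in [B], so the second factor is zero. *)
Lemma coef_gseries_mul_eq0 (A B : {pred nat}) f g d1 d2 n :
  0 < d1 -> (forall a b, a \in A -> b \in B -> n <> d1 * a + d2 * b) ->
  ((gseries A f).[t^ d1] * (gseries B g).[t^ d2])%FPS n = 0%R.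
Proof.
move=> d1_gt0 noAB; rewrite /fps_mul big1 // => -[i /= lt_in] _.
have [/andP[/dvdnP[a ia] Aa]|noti] := boolP ((d1 %| i) && (i %/ d1 \in A)).
  rewrite {}ia mulnK // in lt_in Aa *.
  rewrite [X in (_ * X)%R]gseries_subst_eq0 ?mulr0 // => b Bb.
  by have := noAB a b Aa Bb; lia.
rewrite gseries_subst_eq0 ?mul0r // => a Aa ia; move: noti.
by rewrite ia dvdn_mulr // mulKn ?Aa.
Qed.

(** Only the convolution index [d1 * a] survives: any other index with two nonzero factors would
    give a second expression, with a different element of [A]. *)
Lemma coef_gseries_mul (A B : {pred nat}) f g d1 d2 a b :
  0 < d1 -> 0 < d2 -> a \in A -> b \in B ->
  (forall a' b', a' \in A -> b' \in B ->
     d1 * a + d2 * b = d1 * a' + d2 * b' -> a' = a) ->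
  ((gseries A f).[t^ d1] * (gseries B g).[t^ d2])%FPS (d1 * a + d2 * b)
    = (Posz (f a) * Posz (g b))%R.
Proof.
move=> d1_gt0 d2_gt0 Aa Bb uniq_ab; rewrite /fps_mul.
have lt_a : d1 * a < (d1 * a + d2 * b).+1 by rewrite ltnS leq_addr.
rewrite (bigD1 (Ordinal lt_a)) //= big1 => [|[i lt_i] /=].
  by rewrite addr0 addKn !gseries_subst_mul.
rewrite -val_eqE /= => ne_i.
have [/andP[/dvdnP[a' ia] Aa']|noti] := boolP ((d1 %| i) && (i %/ d1 \in A)).
  rewrite {}ia mulnK // in lt_i ne_i Aa' *.
  rewrite [X in (_ * X)%R]gseries_subst_eq0 ?mulr0 // => b' Bb' eq_b'.
  case/eqP: ne_i; rewrite mulnC; congr (_ * _).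
  by apply: (uniq_ab a' b') => //; lia.
rewrite gseries_subst_eq0 ?mul0r // => a' Aa' ia; move: noti.
by rewrite ia dvdn_mulr // mulKn ?Aa'.
Qed.

Lemma ns_mul (S : numsemigroup) k d : d \in S -> k * d \in S.
Proof.
by move=> Sd; elim: k => [|k IHk]; rewrite ?ns_0 // mulSn ns_add.
Qed.

Section GluingExpressions.
Context {S S1 S2 : numsemigroup} {d1 d2 : nat} (Sglue : gluing S S1 S2 d1 d2).

Lemma gluing_sym : gluing S S2 S1 d2 d1.
Proof.
case: Sglue => ? ? co memS gensS; split=> //; first by rewrite gcdnC.
  move=> n; rewrite memS; split=> -[n1 [n2 [? ? ->]]]; exists n2, n1;
  by split=> //; rewrite addnC.
by move=> n; rewrite gensS !mem_cat orbC.
Qed.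

(** Descent on [n2]: as long as [n2 - d1] stays in [S2], the amount [d1 * d2] moves to the first
    summand, turning [n1] into [n1 + d2], which lies in [S1] because [d2] does. *)
Lemma Apery_expr {n} : n \in S ->
  exists n1 n2, [/\ n1 \in S1, n2 \in Apery S2 d1 & n = d1 * n1 + d2 * n2].
Proof.
have [d1_gt0 _] := gluing_gt0 Sglue.
move=> /(gluing_mem Sglue)[n1 [n2]]; elim/ltn_ind: n2 n1 => n2 IHn2 n1 [n1S n2S eq_n].
have [Ap_n2|] := boolP (n2 \in Apery S2 d1); first by exists n1, n2.
rewrite inE n2S /= negbK => /andP[le_d1 n2dS].
apply: (IHn2 (n2 - d1) _ (n1 + d2)); first by lia.
by split; rewrite ?ns_add ?(gluing_d2 Sglue).1 //; nia.
Qed.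

(** If [m1] exceeded [n1], coprimality would make [n2 - m2] a positive multiple of [d1]. Then
    [n2 - d1] would be [m2] plus a multiple of [d1], hence in [S2], against the choice of [n2]. *)
Lemma Apery_expr_max {n1 n2 m1 m2} : n2 \in Apery S2 d1 -> m2 \in S2 ->
  d1 * n1 + d2 * n2 = d1 * m1 + d2 * m2 -> m1 <= n1.
Proof.
have [d1_gt0 d2_gt0] := gluing_gt0 Sglue.
rewrite inE => /andP[_ nAp] m2S eq_nm; rewrite leqNgt; apply: contraNN nAp => lt_nm.
have eq_diff : d1 * (m1 - n1) = d2 * (n2 - m2) by nia.
(* Quotient zero is impossible: [d1 * (m1 - n1)] is positive. *)
have /dvdnP[[|k] n2m2] : d1 %| n2 - m2.
- by rewrite -(@Gauss_dvdr _ d2) ?/coprime ?(gluing_coprime Sglue) // -eq_diff dvdn_mulr.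
- by nia.
have -> : n2 - d1 = m2 + k * d1 by nia.
by rewrite ns_add ?ns_mul ?(gluing_d1 Sglue).1 // andbT; nia.
Qed.

(** Additivity along Apéry expressions is all that is used about lengths, so one statement serves
    both [maxlen] and [minlen]. *)
Lemma augHilbert_gluing (f f1 f2 : nat -> nat) :
  (forall n1 n2, n1 \in S1 -> n2 \in Apery S2 d1 ->
     f (d1 * n1 + d2 * n2) = f1 n1 + f2 n2) ->
  augHilbert f S =1
  ((Hilbert S1).[t^ d1] * (gseries (Apery S2 d1) f2).[t^ d2]
   + (augHilbert f1 S1).[t^ d1] * (gseries (Apery S2 d1) (fun=> 1)).[t^ d2])%FPS.
Proof.
move=> f_add n; have [d1_gt0 d2_gt0] := gluing_gt0 Sglue.
have ApS m : m \in Apery S2 d1 -> m \in S2 by rewrite inE => /andP[].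
rewrite /fps_add {1}/augHilbert {1}/gseries; case: ifPn => [nS|nNS]; last first.
  have noexpr a b : a \in S1 -> b \in Apery S2 d1 -> n <> d1 * a + d2 * b.
    move=> aS /ApS bS eq_n; case/negP: nNS.
    by apply/(gluing_mem Sglue); exists a, b.
  by rewrite !coef_gseries_mul_eq0.
have [n1 [n2 [n1S n2Ap ->]]] := Apery_expr nS.
(* Each of two Apéry expressions has the maximal first component, so these components agree. *)
have uniq_expr m1 m2 : m1 \in S1 -> m2 \in Apery S2 d1 ->
    d1 * n1 + d2 * n2 = d1 * m1 + d2 * m2 -> m1 = n1.
  move=> m1S m2Ap eq_nm; apply/eqP; rewrite eqn_leq.
  by rewrite (Apery_expr_max n2Ap (ApS _ m2Ap) eq_nm)
             (Apery_expr_max m2Ap (ApS _ n2Ap) (esym eq_nm)).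
by rewrite !coef_gseries_mul // f_add // mul1r mulr1 PoszD addrC.
Qed.

End GluingExpressions.

Theorem theorem5p5 (S S1 S2 : numsemigroup) (d1 d2 : nat)
    (Sglue : gluing S S1 S2 d1 d2) :
  (max_harmonic S S1 S2 d1 d2 ->
     augHilbert (maxlen S) S =1
     ((Hilbert S1).[t^ d1] * (gseries (Apery S2 d1) (maxlen S2)).[t^ d2]
      + (augHilbert (maxlen S1) S1).[t^ d1]
        * (gseries (Apery S2 d1) (fun=> 1)).[t^ d2])%FPS) /\
  (min_harmonic S S1 S2 d1 d2 ->
     augHilbert (minlen S) S =1
     ((gseries (Apery S1 d2) (minlen S1)).[t^ d1] * (Hilbert S2).[t^ d2]
      + (gseries (Apery S1 d2) (fun=> 1)).[t^ d1]
        * (augHilbert (minlen S2) S2).[t^ d2])%FPS).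
Proof.
split=> harm.
  apply: (augHilbert_gluing Sglue) => n1 n2 n1S n2Ap.
  have n2S : n2 \in S2 by move: n2Ap; rewrite inE => /andP[].
  apply: harm => //; first by apply/(gluing_mem Sglue); exists n1, n2.
  by move=> m1 m2 [_ m2S eq_m]; apply: (Apery_expr_max Sglue n2Ap m2S eq_m).
have Sglue' := gluing_sym Sglue.
(* Here harmonicity concerns the expression with maximal second component, which is the first
   component of the exchanged gluing. *)
have add_len n2 n1 : n2 \in S2 -> n1 \in Apery S1 d2 ->
    minlen S (d2 * n2 + d1 * n1) = minlen S2 n2 + minlen S1 n1.
  move=> n2S n1Ap; have n1S : n1 \in S1 by move: n1Ap; rewrite inE => /andP[].
  rewrite addnC [RHS]addnC; apply: harm => //.
    by apply/(gluing_mem Sglue); exists n1, n2.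
  move=> m1 m2 [m1S _ eq_m]; apply: (Apery_expr_max Sglue' n1Ap m1S).
  by rewrite addnC eq_m addnC.
move=> n; rewrite (augHilbert_gluing Sglue' _ _ _ add_len n).
by congr (_ + _)%R; apply: fps_mulC.
Qed.
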